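(* Let $K$ be a field of characteristic zero and let $L/K$ be a finite field extension. Then $(L/K)_{nor}=L^{G(L/K)}$.
   Context: For a finite field extension $L/K$, $G(L/K)=\mathrm{Aut}_{K\text{-alg}}(L)$ and $L^{G(L/K)}$ is its fixed field. An intermediate field $M$ of $L/K$ is called a co-normal subfield if the field extension $L/M$ is normal. $(L/K)_{nor}$ denotes the least (with respect to inclusion) co-normal subfield of $L/K$; thus the claim asserts that $L^{G(L/K)}$ is a co-normal subfield that is contained in every co-normal subfield. *)

(* Defs.v *)
From HB Require Import structures.
From mathcomp Require Import all_boot all_order all_algebra all_field.
From mathcomp Require Import boolp.

Set Implicit Arguments.
Unset Strict Implicit.
Unset Printing Implicit Defensive.

Import GRing.Theory.

Local Open Scope ring_scope.

Section Conormal.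

Variables (K : fieldType) (L : fieldExtType K).

(* The intermediate fields of L / K are the elements of {subfield L}; the
   image of K in L is the subfield 1%AS. *)

(* L / M is normal: every irreducible polynomial over M with a root in L
   splits into linear factors over L (L / M is finite, hence algebraic). *)
Definition normal_ext (M : {subfield L}) : Prop :=
  forall p : {poly subvs_of M}, irreducible_poly p ->
  (exists a : L, root (map_poly vsval p) a) ->
  exists s : seq L, map_poly vsval p %= \prod_(b <- s) ('X - b%:P).

Definition conormal (M : {subfield L}) : Prop := normal_ext M.

Definition is_least_conormal (M : {subfield L}) : Prop :=
  conormal M /\ forall N : {subfield L}, conormal N -> (M <= N)%VS.

(* Membership in G(L / K): mathcomp's 'Gal(_ / _) would require L to be a
   splitting field, i.e. L / K normal, which is not assumed here. *)
Definition is_aut (f : 'End(L)) : bool := kAut 1 {:L} f.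

Lemma aut_fixed_field_exists :
  exists M : {subfield L},
    forall x : L, x \in M <-> forall f, is_aut f -> f x = x.
Proof.
pose I (s : seq 'End(L)) := (\bigcap_(f <- s) fixedSpace f)%VS.
pose P n := `[< exists2 s : seq 'End(L), all is_aut s & \dim (I s) = n >].
have exP : exists n, P n.
  by exists (\dim (I [::])); apply/asboolP; exists [::].
case: (ex_minnP exP) => n /asboolP[s autS dimI] minn.
have IP x : x \in I s <-> forall f, is_aut f -> f x = x.
  split=> [Ix f autf | fixx].
    have sub : (I (f :: s) <= I s)%VS by rewrite /I big_cons capvSr.
    have : (\dim (I s) <= \dim (I (f :: s)))%N.
      rewrite dimI; apply: minn; apply/asboolP.
      by exists (f :: s); rewrite //= autf.
    move=> le_dim; have /eqP eqI : I (f :: s) == I s.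
      by rewrite eqEdim sub le_dim.
    move: Ix; rewrite -eqI /I big_cons memv_cap => /andP[fx _].
    exact/fixedSpaceP.
  rewrite /I; elim: s autS {dimI minn} => [|f s IHs] /=.
    by rewrite big_nil memvf.
  case/andP=> autf autS; rewrite big_cons memv_cap IHs // andbT.
  by apply/fixedSpaceP/fixx.
have autM f : is_aut f -> monoid_morphism f.
  by case/andP=> /kHom_monoid_morphism.
have spaceI : is_aspace (I s).
  rewrite /is_aspace has_algid1 /=.
    apply/prodvP => u v /IP fu /IP fv; apply/IP => f autf.
    by have [_ ->] := autM f autf; rewrite fu ?fv.
  by apply/IP => f autf; have [] := autM f autf.
by exists (ASpace spaceI).
Qed.

(* The fixed field L^G(L / K). *)
Definition aut_fixed_field : {subfield L} :=
  proj1_sig (cid aut_fixed_field_exists).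

Lemma mem_aut_fixed_field (x : L) :
  x \in aut_fixed_field <-> forall f, is_aut f -> f x = x.
Proof. exact: (proj2_sig (cid aut_fixed_field_exists)). Qed.

End Conormal.

Arguments aut_fixed_field {K} L.

(* Main.v *)
Require Import Defs.
From HB Require Import structures.
From mathcomp Require Import all_boot all_order all_algebra all_field.
From mathcomp Require Import boolp.

Set Implicit Arguments.
Unset Strict Implicit.
Unset Printing Implicit Defensive.

Import GRing.Theory.

Local Open Scope ring_scope.

(** For a in L, the product of 'X - b over the (finite) orbit of a under
    G(L/K) has coefficients in the fixed field, so every irreducible polynomial
    over the fixed field with root a divides it and therefore splits in L.
    Conversely let N be co-normal and x in L outside N. The minimal polynomial
    of x over N splits in L and, in characteristic zero, has another root y;
    the N-embedding N(x) -> L sending x to y extends to an automorphism because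
    L is a splitting field over N. Hence x is not fixed by G(L/K). *)

(** Conjugates of [a] are roots of its minimal polynomial over [K], so duplicate-free lists of them
    have bounded length. One of maximal length misses no conjugate. *)
Lemma aut_orbit_seq (K : fieldType) (L : fieldExtType K) (a : L) :
  exists2 s : seq L, uniq s &
    forall b, b \in s <-> exists2 f : 'End(L), is_aut f & f a = b.
Proof.
pose conj b := exists2 f : 'End(L), is_aut f & f a = b.
pose P n := `[< exists s : seq L,
  [/\ uniq s, size s = n & forall b, b \in s -> conj b] >].
have exP : exists n, P n by exists 0%N; apply/asboolP; exists [::].
have bndP n : P n -> (n <= adjoin_degree 1%AS a)%N.
  move=> /asboolP[s [Us <- sconj]]; rewrite -ltnS -size_minPoly.
  apply: max_poly_roots Us; first exact/monic_neq0/monic_minPoly.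
  apply/allP=> _ /sconj[f /kHom_kAut_sub homf <-].
  by apply: (kHom_root_id _ homf); rewrite ?subvf ?memvf ?minPolyOver ?root_minPoly.
case: (ex_maxnP exP bndP) => n /asboolP[s [Us sz_s sconj]] maxn.
exists s => // b; split=> [/sconj // | conj_b].
apply/negPn/negP=> s'b; suff /maxn : P n.+1 by rewrite ltnn.
apply/asboolP; exists (b :: s); split; rewrite /= ?s'b ?sz_s //.
by move=> c; rewrite inE => /predU1P[-> // | /sconj].
Qed.

Lemma map_poly_aut_orbit (K : fieldType) (L : fieldExtType K) (a : L)
    (s : seq L) (f : 'End(L)) :
    uniq s ->
    (forall b, b \in s <-> exists2 g : 'End(L), is_aut g & g a = b) ->
    is_aut f ->
  map_poly f (\prod_(b <- s) ('X - b%:P)) = \prod_(b <- s) ('X - b%:P).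
Proof.
move=> Us sP autf; have homf := kHom_kAut_sub autf.
have injf : injective f by apply/lker0P; apply: kAutf_lker0 homf.
have fM := kHom_monoid_morphism homf.
pose fmM := GRing.isMonoidMorphism.Build _ _ _ fM.
pose fRM : {rmorphism _ -> _} := HB.pack (fun_of_lfun f) fmM.
rewrite (map_prod_XsubC fRM) -(big_map f xpredT (fun b => 'X - b%:P)).
apply: perm_big; apply: uniq_perm; rewrite ?map_inj_uniq //.
(* The orbit is stable under [f] by composition; since [f] is injective and [s] finite, [f] then
   permutes [s]. *)
have sub_fs : {subset map f s <= s}.
  move=> _ /mapP[_ /sP[g autg <-] ->]; apply/sP; exists (f \o g)%VF.
    rewrite /is_aut kAutfE; apply: comp_kHom homf _.
    exact: kHom_kAut_sub autg.
  by rewrite lfunE.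
have [] // := uniq_min_size _ sub_fs _; first by rewrite map_inj_uniq.
by rewrite size_map.
Qed.

Lemma conormal_aut_fixed_field (K : fieldType) (L : fieldExtType K) :
  conormal (aut_fixed_field L).
Proof.
move=> p irr_p [a pa0].
have [s Us sP] := aut_orbit_seq a.
set q := \prod_(b <- s) ('X - b%:P).
have /polyOver_subvs[q' Dq] : q \is a polyOver (aut_fixed_field L).
  apply/polyOverP=> i; apply/mem_aut_fixed_field=> f autf.
  have fq : map_poly f q = q := map_poly_aut_orbit Us sP autf.
  by rewrite -[in RHS]fq coef_map.
have qa0 : root q a.
  rewrite root_prod_XsubC; apply/sP; exists \1%VF; last by rewrite lfunE.
  by rewrite /is_aut kAutfE kHom1.
(* Otherwise the irreducible [p] would be coprime to [q'], and coprimality survives in [L], where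
   [a] is a common root. *)
have p_dv_q : map_poly vsval p %| q.
  rewrite Dq dvdp_map; apply: contraLR qa0.
  rewrite -irreducible_poly_coprime // -(coprimep_map vsval) -Dq => co_pq.
  exact: coprimep_root co_pq pa0.
have [m Dp] := dvdp_prod_XsubC p_dv_q.
by exists (mask m s).
Qed.

(** Transfers irreducibility from polynomials over [L] with coefficients in [N] to the type
    [{poly subvs_of N}] on which [normal_ext] is stated. *)
Lemma irreducible_minPoly (K : fieldType) (L : fieldExtType K)
    (N : {subfield L}) (x : L) (q : {poly subvs_of N}) :
  minPoly N x = map_poly vsval q -> irreducible_poly q.
Proof.
move=> Dq; have sz_q : size q = (adjoin_degree N x).+1.
  by rewrite -size_minPoly Dq size_map_poly.
split=> [|d sz_d d_dv_q]; first by rewrite sz_q.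
have := @minPoly_irr _ _ N x (map_poly vsval d).
rewrite Dq dvdp_map eqp_map -size_poly_eq1 size_map_poly (negPf sz_d) orbF.
by apply=> //; apply/polyOver_subvs; exists d.
Qed.

Lemma conormal_minPoly (K : fieldType) (L : fieldExtType K)
    (N : {subfield L}) (x : L) :
  conormal N -> exists s : seq L, minPoly N x = \prod_(b <- s) ('X - b%:P).
Proof.
move=> norN; have /polyOver_subvs[q Dq] := minPolyOver N x.
have [|s Ds] := norN q (irreducible_minPoly Dq).
  by exists x; rewrite -Dq root_minPoly.
exists s; apply/eqP; rewrite -eqp_monic ?monic_minPoly ?monic_prod_XsubC //.
by rewrite Dq.
Qed.

(** Take for [p] the product of the minimal polynomials over [N] of a [K]-basis of [L]: it splits,
    and its roots span [L]. *)
Lemma conormal_splitting (K : fieldType) (L : fieldExtType K)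
    (N : {subfield L}) :
  conormal N -> exists2 p, p \is a polyOver N & splittingFieldFor N p {:L}.
Proof.
move=> norN.
have splitX (X : seq L) : exists p rs, [/\ p \is a polyOver N,
    p %= \prod_(z <- rs) ('X - z%:P) & {subset X <= rs}].
  elim: X => [|x X [p [rs [Np Dp sXrs]]]].
    by exists 1, [::]; split; rewrite ?rpred1 ?big_nil ?eqpxx.
  have [s Ds] := conormal_minPoly x norN.
  exists (minPoly N x * p), (s ++ rs); split.
  - by rewrite rpredM ?minPolyOver.
  - by rewrite big_cat /= -Ds eqp_mull.
  move=> y; rewrite inE mem_cat => /predU1P[-> | /sXrs->]; last exact: orbT.
  by rewrite -root_prod_XsubC -Ds root_minPoly.
have [p [rs [Np Dp sbrs]]] := splitX (vbasis {:L}).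
exists p => //; exists rs => //; apply/eqP.
rewrite eqEsubv subvf -(span_basis (vbasisP {:L})).
by apply/span_subvP=> x /sbrs/seqv_sub_adjoin.
Qed.

Lemma conormal_kHom_root (K : fieldType) (L : fieldExtType K)
    (N : {subfield L}) (x y : L) :
    conormal N -> root (minPoly N x) y ->
  exists2 f : 'End(L), kHom N {:L} f & f x = y.
Proof.
move=> norN Nxy.
have [p Np splitp] := conormal_splitting norN.
have hom1 := kHom1 N N.
have Nxy1 : root (map_poly \1%VF (minPoly N x)) y.
  by rewrite (kHom_poly_id hom1) ?minPolyOver.
have homx := kHomExtendP (subvv N) hom1 Nxy1.
have sNNx : (N <= <<N; x>>%AS)%VS := subv_adjoin N x.
(* [L] is still a splitting field of [p] over the larger base [N(x)], which allows the extension
   from [N(x)] to [L]. *)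
have splitNx := splittingFieldForS sNNx (subvf <<N; x>>%AS) splitp.
have [f homf eq_f] := kHom_extends sNNx homx Np splitNx.
by exists f; rewrite // -eq_f ?memv_adjoin // (kHomExtend_val hom1 Nxy1).
Qed.

Lemma conormal_other_root (K : fieldType) (L : fieldExtType K)
    (N : {subfield L}) (x : L) :
    conormal N -> separable_element N x -> x \notin N ->
  exists2 y, root (minPoly N x) y & y != x.
Proof.
move=> norN sepx; have [s Ds] := conormal_minPoly x norN.
have Us : uniq s by rewrite -separable_prod_XsubC -Ds.
rewrite -adjoin_deg_eq1 -eqSS -size_minPoly Ds size_prod_XsubC eqSS => sz_s.
have [/allP s_x | /allPn[y s_y y'x]] := boolP (all (pred1 x) s); last first.
  by exists y; rewrite // root_prod_XsubC.
(* If [x] were the only root, the duplicate-free [s] would have length 1, so [x] would have degree 1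
   over [N]. *)
have s_sub : {subset s <= [:: x]} by move=> y /s_x/=; rewrite inE.
have xs : x \in s by rewrite -root_prod_XsubC -Ds root_minPoly.
case/eqP: sz_s; apply/eqP; rewrite eqn_leq (uniq_leq_size Us s_sub) /=.
by case: (s) xs.
Qed.

Theorem proposition8p5 (K : fieldType) (L : fieldExtType K)
    (charK : [pchar K] =i pred0) :
  is_least_conormal (aut_fixed_field L).
Proof.
split; first exact: conormal_aut_fixed_field.
move=> N norN; apply/subvP=> x /mem_aut_fixed_field fixx.
have charL : [pchar L] =i pred0 by move=> p; rewrite pchar_lalg charK.
apply/negPn/negP=> N'x.
have [y Nxy /eqP[]] :=
  conormal_other_root norN (pcharf0_separable N charL x) N'x.
have [f homf <-] := conormal_kHom_root norN Nxy.
by apply: fixx; rewrite /is_aut kAutfE (kHomSl (sub1v N) homf).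
Qed.
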